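(* Let $R,S$ be rings, let $\mathcal{X}\subseteq \mathrm{mod}\text{-}R$ be covariantly finite in $\mathrm{mod}\text{-}R$, let $\mathcal{C}$ be the smallest definable subcategory of $\mathrm{Mod}\text{-}R$ containing $\mathcal{X}$, and let $\mathcal{D}$ be a definable subcategory of $\mathrm{Mod}\text{-}S$. Let $I:\mathcal{C}\rightarrow \mathcal{D}$ be an interpretation functor such that $I$ is full on $\mathcal{X}$ (i.e. $\mathrm{Hom}_R(X,Y)\to\mathrm{Hom}_S(IX,IY)$, $f\mapsto If$, is surjective for all $X,Y\in\mathcal{X}$) and such that $IM\in\mathrm{mod}\text{-}S$ for every $M\in\mathcal{C}\cap\mathrm{mod}\text{-}R$. Then $I$ is full on pure-injectives, i.e. for all pure-injective modules $N',N\in\mathcal{C}$ and every $g\in \mathrm{Hom}_S(IN',IN)$ there is $h\in\mathrm{Hom}_R(N',N)$ with $Ih=g$.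
   Context: $\mathrm{Mod}\text{-}R$ is the category of right $R$-modules and $\mathrm{mod}\text{-}R$ the full subcategory of finitely presented right $R$-modules. A (right) pp-$n$-formula is a formula $\exists \mathbf{y}\,(\mathbf{x}\mathbf{y})A=0$ with $\mathbf{x}$ an $n$-tuple of variables, $\mathbf{y}$ a finite tuple of variables and $A$ a matrix over $R$; $\phi(M)\subseteq M^n$ denotes its solution set (a subgroup) in $M$. A pp-$n$-pair $\phi/\psi$ is a pair of pp-$n$-formulas with $\psi(M)\subseteq\phi(M)$ for all $M\in\mathrm{Mod}\text{-}R$. An embedding $i:A\to B$ is pure if $\phi(B)\cap iA=i\phi(A)$ for all pp-1-formulas $\phi$; a module $M$ is pure-injective if every pure embedding $M\to B$ splits. A definable subcategory of $\mathrm{Mod}\text{-}R$ is a full subcategory closed under products, direct limits and pure submodules. A full subcategory $\mathcal{X}\subseteq\mathrm{mod}\text{-}R$, closed under isomorphism, finite direct sums and direct summands, is covariantly finite in $\mathrm{mod}\text{-}R$ if for every $M\in\mathrm{mod}\text{-}R$ there is a homomorphism $f_M:M\to M_{\mathcal{X}}$ with $M_{\mathcal{X}}\in\mathcal{X}$ such that every homomorphism $M\to L$ with $L\in\mathcal{X}$ factors through $f_M$. An interpretation functor $I:\mathcal{C}\to\mathcal{D}$ between definable subcategories $\mathcal{C}\subseteq\mathrm{Mod}\text{-}R$, $\mathcal{D}\subseteq\mathrm{Mod}\text{-}S$ is an additive functor equivalent to one of the following form: there are a pp-$m$-pair $\phi/\psi$ over $R$ and, for each $s\in S$, a pp-$2m$-formula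 $\rho_s(\overline{x},\overline{y})$ such that for each $M\in\mathcal{C}$, $\rho_s(M,M)\subseteq M^m\times M^m$ defines an endomorphism of the abelian group $\phi(M)/\psi(M)$, and $\phi(M)/\psi(M)$ with $s\in S$ acting through $\rho_s$ is an $S$-module in $\mathcal{D}$; then $IM=\phi(M)/\psi(M)$ with this $S$-action. Equivalently (Krause, Prest), $I$ is an additive functor commuting with direct limits and products. *)

(* Defs.v *)
From HB Require Import structures.
From mathcomp Require Import all_boot all_order all_algebra.
From mathcomp Require Import boolp.

Set Implicit Arguments.
Unset Strict Implicit.
Unset Printing Implicit Defensive.

Import GRing.Theory.
Local Open Scope ring_scope.
Local Open Scope quotient_scope.

(* Right R-modules are left modules over the converse ring R^c: the product   *)
(* written x.a is the scaling of x by a : R^c, so that (x.a).b = x.(a * b).   *)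
Notation rmod R := (lmodType (R : pzRingType)^c).

Section RightModules.
Variable R : pzRingType.

Definition ract (M : rmod R) (x : M) (a : R) : M := (a : R^c) *: x.

(* (x_1, ..., x_p) A, for a row of elements of M and a matrix A over R.       *)
Definition rmulmx (M : rmod R) p q (x : 'rV[M]_p) (A : 'M[R]_(p, q)) :
  'rV[M]_q := \row_j \sum_i ract (x 0 i) (A i j).

(* M is the cokernel of A : R^k -> R^n, the column x_j being the image of the *)
(* j-th basis vector of R^n.                                                  *)
Definition finitely_presented (M : rmod R) : Prop :=
  exists n k (A : 'M[R]_(n, k)) (x : 'rV[M]_n),
  [/\ forall m : M, exists r : 'cV[R]_n, rmulmx x r = const_mx m,
      rmulmx x A = 0
    & forall r : 'cV[R]_n, rmulmx x r = 0 ->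
        exists s : 'cV[R]_k, r = A *m s].

(* The pp-n-formula "exists y, (x y) A = 0". *)
Record pp_formula (n : nat) := PPFormula {
  pp_ex : nat;
  pp_eqs : nat;
  pp_mx : 'M[R]_(n + pp_ex, pp_eqs) }.

Definition pp_sol n (phi : pp_formula n) (M : rmod R) (x : 'rV[M]_n) : Prop :=
  exists y : 'rV[M]_(pp_ex phi), rmulmx (row_mx x y) (pp_mx phi) = 0.

Definition pp_pair n (phi psi : pp_formula n) : Prop :=
  forall (M : rmod R) (x : 'rV[M]_n), pp_sol psi x -> pp_sol phi x.

Definition pure_embedding (A B : rmod R) (i : {linear A -> B}) : Prop :=
  injective i /\
  forall (phi : pp_formula 1) (b : B),
    (pp_sol phi (const_mx b) /\ exists a : A, b = i a) <->
    (exists2 a : A, pp_sol phi (const_mx a) & b = i a).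

Definition pure_injective (M : rmod R) : Prop :=
  forall (B : rmod R) (i : {linear M -> B}), pure_embedding i ->
    exists r : {linear B -> M}, forall x, r (i x) = x.

Definition is_product (I : Type) (M : I -> rmod R) (P : rmod R)
    (p : forall i, {linear P -> M i}) : Prop :=
  forall (N : rmod R) (f : forall i, {linear N -> M i}),
  exists h : {linear N -> P},
    (forall i, p i \o h =1 f i) /\
    (forall h' : {linear N -> P}, (forall i, p i \o h' =1 f i) -> h' =1 h).

Definition directed (I : Type) (le : I -> I -> Prop) : Prop :=
  [/\ inhabited I, forall i, le i i,
      forall i j k, le i j -> le j k -> le i k
    & forall i j, exists k, le i k /\ le j k].

Definition direct_system (I : Type) (le : I -> I -> Prop) (M : I -> rmod R)
    (f : forall i j, le i j -> {linear M i -> M j}) : Prop :=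
  [/\ directed le,
      forall i (h : le i i), f i i h =1 id
    & forall i j k (hij : le i j) (hjk : le j k) (hik : le i k),
        f j k hjk \o f i j hij =1 f i k hik].

Definition is_direct_limit (I : Type) (le : I -> I -> Prop) (M : I -> rmod R)
    (f : forall i j, le i j -> {linear M i -> M j})
    (L : rmod R) (u : forall i, {linear M i -> L}) : Prop :=
  (forall i j (h : le i j), u j \o f i j h =1 u i) /\
  forall (N : rmod R) (v : forall i, {linear M i -> N}),
    (forall i j (h : le i j), v j \o f i j h =1 v i) ->
    exists w : {linear L -> N},
      (forall i, w \o u i =1 v i) /\
      (forall w' : {linear L -> N}, (forall i, w' \o u i =1 v i) -> w' =1 w).

(* Full subcategories are given by predicates on objects.  Closure under      *)
(* isomorphism is a consequence, isomorphisms being pure embeddings.          *)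
Record definable (C : rmod R -> Prop) : Prop := Definable {
  definable_prod : forall (I : Type) (M : I -> rmod R) (P : rmod R)
      (p : forall i, {linear P -> M i}),
    is_product p -> (forall i, C (M i)) -> C P;
  definable_lim : forall (I : Type) (le : I -> I -> Prop) (M : I -> rmod R)
      (f : forall i j, le i j -> {linear M i -> M j})
      (L : rmod R) (u : forall i, {linear M i -> L}),
    direct_system f -> is_direct_limit f u -> (forall i, C (M i)) -> C L;
  definable_pure : forall (A B : rmod R) (i : {linear A -> B}),
    pure_embedding i -> C B -> C A }.

Definition definable_closure (X : rmod R -> Prop) (M : rmod R) : Prop :=
  forall C : rmod R -> Prop, definable C -> (forall N, X N -> C N) -> C M.

Record covariantly_finite (X : rmod R -> Prop) : Prop := CovariantlyFinite {
  cf_fp : forall M, X M -> finitely_presented M;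
  cf_iso : forall (M N : rmod R) (f : {linear M -> N}),
    bijective f -> X M -> X N;
  cf_zero : forall M : rmod R, (forall x : M, x = 0) -> X M;
  cf_sum : forall M N : rmod R, X M -> X N -> X (M * N)%type;
  cf_summand : forall M N : rmod R, X (M * N)%type -> X M;
  cf_approx : forall M : rmod R, finitely_presented M ->
    exists (MX : rmod R) (fM : {linear M -> MX}), X MX /\
      forall (L : rmod R) (g : {linear M -> L}), X L ->
        exists h : {linear MX -> L}, h \o fM =1 g }.

Record obj (C : rmod R -> Prop) := Obj {
  carrier :> rmod R;
  objP : C carrier }.

End RightModules.

Record additive_functor (R S : pzRingType)
    (C : rmod R -> Prop) (D : rmod S -> Prop) := AdditiveFunctor {
  fobj :> obj C -> obj D;
  fmap : forall M N : obj C, {linear M -> N} -> {linear fobj M -> fobj N};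
  fmap_id : forall M : obj C, fmap (idfun : {linear M -> M}) =1 id;
  fmap_comp : forall (M N P : obj C) (g : {linear N -> P}) (f : {linear M -> N}),
    fmap (g \o f : {linear M -> P}) =1 fmap g \o fmap f;
  fmap_add : forall (M N : obj C) (f g : {linear M -> N}),
    fmap (f \+ g : {linear M -> N}) =1 fmap f \+ fmap g }.

Definition nat_iso (R S : pzRingType) (C : rmod R -> Prop) (D : rmod S -> Prop)
    (F G : additive_functor C D) : Prop :=
  exists theta : forall M : obj C, {linear F M -> G M},
    (forall M, bijective (theta M)) /\
    (forall (M N : obj C) (f : {linear M -> N}),
       theta N \o fmap F f =1 fmap G f \o theta M).

Section PPSubgroups.
Variable R : pzRingType.

Lemma rmulmxB (M : rmod R) p q (x y : 'rV[M]_p) (A : 'M[R]_(p, q)) :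
  rmulmx (x - y) A = rmulmx x A - rmulmx y A.
Proof.
apply/rowP=> j; rewrite !mxE -sumrB; apply: eq_bigr => i _.
by rewrite /ract !mxE scalerBr.
Qed.

Lemma rmulmx_map (M N : rmod R) (f : {linear M -> N}) p q (x : 'rV[M]_p)
    (A : 'M[R]_(p, q)) : rmulmx (map_mx f x) A = map_mx f (rmulmx x A).
Proof.
apply/rowP=> j; rewrite !mxE linear_sum; apply: eq_bigr => i _.
by rewrite /ract !mxE linearZ_LR.
Qed.

Lemma pp_sol_zmod n (phi : pp_formula R n) (M : rmod R) :
  zmod_closed [pred x : 'rV[M]_n | `[< pp_sol phi x >]].
Proof.
split=> [|x y]; rewrite ?inE.
  apply/asboolP; exists 0; rewrite row_mx0.
  by rewrite -[X in rmulmx X _](subrr 0) rmulmxB subrr.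
move=> /asboolP[u Eu] /asboolP[v Ev]; apply/asboolP; exists (u - v).
by rewrite -add_row_mx -opp_row_mx rmulmxB Eu Ev subrr.
Qed.

Lemma pp_sol_map n (phi : pp_formula R n) (M N : rmod R) (f : {linear M -> N})
  (x : 'rV[M]_n) : pp_sol phi x -> pp_sol phi (map_mx f x).
Proof.
by case=> y E; exists (map_mx f y); rewrite -map_row_mx rmulmx_map E map_mx0.
Qed.

Section Quotient.
Variables (n : nat) (phi psi : pp_formula R n) (M : rmod R).

Definition pp_pred : {pred 'rV[M]_n} := fun x => `[< pp_sol phi x >].
HB.instance Definition _ :=
  GRing.isZmodClosed.Build 'rV[M]_n pp_pred (pp_sol_zmod phi M).

(* phi(M) is a subtype of M^n.  The quotient phi(M)/psi(M) is formed by       *)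
(* psi(M) restricted to that subtype, so it makes sense before psi(M) is      *)
(* known to be contained in phi(M).                                           *)
Record pp_group := PPGroup {
  pp_val :> 'rV[M]_n;
  _ : pp_pred pp_val }.
HB.instance Definition _ := [isSub for pp_val].
HB.instance Definition _ := [Choice of pp_group by <:].
HB.instance Definition _ := [SubChoice_isSubZmodule of pp_group by <:].

Lemma pp_groupP (x : pp_group) : pp_sol phi x.
Proof. by case: x => x /= /asboolP. Qed.

Definition pp_sub : {pred pp_group} := fun x => `[< pp_sol psi (x : 'rV[M]_n) >].
Lemma pp_sub_zmod : zmod_closed pp_sub.
Proof.
have [H0 HB] := pp_sol_zmod psi M.
by split=> [|x y Hx Hy]; [apply: H0 | apply: (HB (val x) (val y) Hx Hy)].
Qed.
HB.instance Definition _ :=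
  GRing.isZmodClosed.Build pp_group pp_sub pp_sub_zmod.

Definition pp_quot : zmodType := Quotient.quot pp_sub.

Definition pp_class (x : pp_group) : pp_quot := \pi_(Quotient.quot pp_sub) x.

Lemma pp_class_surj (u : pp_quot) : exists x, u = pp_class x.
Proof. by exists (repr u); rewrite /pp_class reprK. Qed.

Lemma pp_class_eq (x y : pp_group) :
  pp_class x = pp_class y <-> pp_sol psi (x - y : 'rV[M]_n).
Proof.
split=> [/eqP|H].
  by rewrite /pp_class -Quotient.idealrBE => /asboolP.
by apply/eqP; rewrite /pp_class -Quotient.idealrBE; apply/asboolP.
Qed.

Lemma pp_class_additive : zmod_morphism pp_class.
Proof. by move=> x y; rewrite /pp_class; exact: raddfB. Qed.
HB.instance Definition _ :=
  GRing.isZmodMorphism.Build pp_group pp_quot pp_class pp_class_additive.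

(* The relation on phi(M)/psi(M) induced by rho(M, M). *)
Definition pp_rel (rho : pp_formula R (n + n)) (u v : pp_quot) : Prop :=
  exists x y : pp_group,
    [/\ u = pp_class x, v = pp_class y
      & pp_sol rho (row_mx (x : 'rV[M]_n) (y : 'rV[M]_n))].

Definition defines_endo (rho : pp_formula R (n + n)) : Prop :=
  exists e : {additive pp_quot -> pp_quot},
    forall u v, pp_rel rho u v <-> e u = v.

End Quotient.
End PPSubgroups.

Section PPInterpretation.
Variables R S : pzRingType.

Record pp_data := PPData {
  pp_arity : nat;
  pp_num : pp_formula R pp_arity;
  pp_den : pp_formula R pp_arity;
  pp_rho : S -> pp_formula R (pp_arity + pp_arity);
  pp_dataP : pp_pair pp_num pp_den }.

Local Notation quot d M := (pp_quot (pp_num d) (pp_den d) M).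
Local Notation rel d s := (@pp_rel R _ (pp_num d) (pp_den d) _ (pp_rho d s)).

(* The formulas rho_s define endomorphisms of the group phi(M)/psi(M), and    *)
(* these make it a right S-module.  The axiom x.(s + t) = x.s + x.t is        *)
(* required; additivity in x is part of being an endomorphism.                *)
Record pp_acts (d : pp_data) (M : rmod R) : Prop := PPActs {
  pp_acts_endo : forall s : S,
    defines_endo (pp_num d) (pp_den d) M (pp_rho d s);
  pp_acts1 : forall u : quot d M, rel d 1 u u;
  pp_actsD : forall (s t : S) (u v w : quot d M),
    rel d s u v -> rel d t u w -> rel d (s + t) u (v + w);
  pp_actsM : forall (s t : S) (u v w : quot d M),
    rel d s u v -> rel d t v w -> rel d (s * t) u w }.

Section Module.
Variables (d : pp_data) (M : rmod R) (dM : pp_acts d M).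

Definition pp_act (s : S) : {additive quot d M -> quot d M} :=
  projT1 (cid (pp_acts_endo dM s)).

Lemma pp_actP s u v : rel d s u v <-> pp_act s u = v.
Proof. exact: projT2 (cid (pp_acts_endo dM s)) u v. Qed.

(* An alias of the group phi(M)/psi(M), carrying the S-action through rho.    *)
Definition pp_module_of & pp_acts d M : Type := quot d M.
Notation Q := (pp_module_of dM).
HB.instance Definition _ := GRing.Zmodule.on Q.

Definition pp_scale (s : S^c) (u : Q) : Q := pp_act s u.

Fact pp_scaleA s t u : pp_scale s (pp_scale t u) = pp_scale (s * t) u.
Proof.
by apply/esym/pp_actP; apply: (@pp_actsM d M dM t s u (pp_act t u));
  apply/pp_actP.
Qed.
Fact pp_scale1 : left_id 1 pp_scale.
Proof. by move=> u; apply/pp_actP/pp_acts1. Qed.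
Fact pp_scaleDr : right_distributive pp_scale +%R.
Proof. by move=> s u v; rewrite /pp_scale; exact: raddfD. Qed.
Fact pp_scaleDl u : {morph pp_scale^~ u : s t / s + t}.
Proof. by move=> s t; apply/pp_actP; apply: pp_actsD => //; apply/pp_actP. Qed.

HB.instance Definition _ := GRing.Zmodule_isLmodule.Build S^c Q
  pp_scaleA pp_scale1 pp_scaleDr pp_scaleDl.

Definition pp_module : rmod S := Q.

End Module.

Section Map.
Variables (d : pp_data) (M N : rmod R) (dM : pp_acts d M) (dN : pp_acts d N).
Variable f : {linear M -> N}.

Fact pp_group_map_subproof (x : pp_group (pp_num d) M) :
  pp_pred (pp_num d) (map_mx f x).
Proof. exact/asboolP/pp_sol_map/pp_groupP. Qed.

Definition pp_group_map (x : pp_group (pp_num d) M) : pp_group (pp_num d) N :=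
  PPGroup (pp_group_map_subproof x).

Definition pp_module_map (u : pp_module dM) : pp_module dN :=
  pp_class (pp_den d) (pp_group_map (repr (u : Quotient.quot _))).

Lemma pp_module_mapE (x : pp_group (pp_num d) M) :
  pp_module_map (pp_class (pp_den d) x) = pp_class (pp_den d) (pp_group_map x).
Proof.
apply/pp_class_eq; rewrite /= -map_mxB; apply: pp_sol_map.
by apply/pp_class_eq; rewrite /pp_class reprK.
Qed.

Lemma pp_module_map_is_additive : zmod_morphism pp_module_map.
Proof.
move=> u v; have [x ->] := pp_class_surj u; have [y ->] := pp_class_surj v.
have -> : pp_class (pp_den d) x - pp_class (pp_den d) y
  = pp_class (pp_den d) (x - y) by rewrite raddfB.
rewrite !pp_module_mapE.
transitivity (pp_class (pp_den d) (pp_group_map x - pp_group_map y)).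
  by congr pp_class; apply/val_inj; rewrite /= map_mxB.
exact: raddfB.
Qed.

Lemma pp_module_map_is_scalable : scalable pp_module_map.
Proof.
move=> s u; apply/esym/pp_actP.
have /pp_actP[x [y [-> Ey Hxy]]] : pp_act dM s u = s *: u by [].
rewrite Ey; exists (pp_group_map x), (pp_group_map y).
split; rewrite ?pp_module_mapE //=.
by rewrite -map_row_mx; apply: pp_sol_map.
Qed.

HB.instance Definition _ := GRing.isZmodMorphism.Build _ _ pp_module_map
  pp_module_map_is_additive.
HB.instance Definition _ := GRing.isScalable.Build _ _ _ _ pp_module_map
  pp_module_map_is_scalable.

End Map.
Arguments pp_module_map {d M N} dM dN f u.

Section Functor.
Variables (C : rmod R -> Prop) (D : rmod S -> Prop).

Record pp_interpretation := PPInterpretation {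
  pp_idata :> pp_data;
  pp_iacts : forall M, C M -> pp_acts pp_idata M;
  pp_iobj : forall M (CM : C M), D (pp_module (pp_iacts CM)) }.

Variable d : pp_interpretation.

Definition pp_fobj (M : obj C) : obj D := Obj (pp_iobj d (objP M)).

Definition pp_fmap (M N : obj C) (f : {linear M -> N}) :
    {linear pp_fobj M -> pp_fobj N} :=
  pp_module_map (pp_iacts d (objP M)) (pp_iacts d (objP N)) f.

Fact pp_fmap_id (M : obj C) : pp_fmap (idfun : {linear M -> M}) =1 id.
Proof.
move=> u; have [x ->] := pp_class_surj u.
rewrite [LHS]pp_module_mapE; congr pp_class.
by apply/val_inj; rewrite /= map_mx_id.
Qed.

Fact pp_fmap_comp (M N P : obj C) (g : {linear N -> P}) (f : {linear M -> N}) :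
  pp_fmap (g \o f : {linear M -> P}) =1 pp_fmap g \o pp_fmap f.
Proof.
move=> u; have [x ->] := pp_class_surj u.
rewrite [LHS]pp_module_mapE /= !pp_module_mapE; congr pp_class.
by apply/val_inj; rewrite /= map_mx_comp.
Qed.

Fact pp_fmap_add (M N : obj C) (f g : {linear M -> N}) :
  pp_fmap (f \+ g : {linear M -> N}) =1 pp_fmap f \+ pp_fmap g.
Proof.
move=> u; have [x ->] := pp_class_surj u.
rewrite [LHS]pp_module_mapE /= !pp_module_mapE.
transitivity (pp_class (pp_den d) (pp_group_map f x + pp_group_map g x)).
  by congr pp_class; apply/val_inj/matrixP => i j; rewrite !mxE.
exact: raddfD.
Qed.

Definition pp_functor : additive_functor C D :=
  AdditiveFunctor pp_fmap_id pp_fmap_comp pp_fmap_add.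

End Functor.

Definition interpretation_functor (C : rmod R -> Prop) (D : rmod S -> Prop)
    (I : additive_functor C D) : Prop :=
  exists d : pp_interpretation C D, nat_iso I (pp_functor d).

End PPInterpretation.

(* Main.v *)
Require Import Defs.
From HB Require Import structures.
From mathcomp Require Import all_boot all_order all_algebra.
From mathcomp Require Import boolp.

(* Every map from a finitely presented module to a module N of the definable  *)
(* closure of X factors through an object of X: the modules N with this       *)
(* property form a definable subcategory, by means of left X-approximations.  *)
(* Hence a finite system of pp-conditions solvable in N is already solvable   *)
(* in some Y in X, compatibly with a map Y -> N.                              *)
(*   For M in X, the image of a presentation of I M under a map I M -> I N is *)
(* such a finite system; this factors the map through some I Y, and fullness  *)
(* on X lifts it to a map M -> Y -> N.                                        *)
(*   For arbitrary M in the closure, "h : M -> N is linear and I h = g" is an *)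
(* infinite system of pp-conditions on the values of h.  Each finite part of  *)
(* it is solvable, by factoring its lift through an object of X.  The partial *)
(* solutions define a solution in a reduced power of N, and N, being pure-    *)
(* injective, is a retract of that reduced power.                             *)

Set Implicit Arguments.
Unset Strict Implicit.
Unset Printing Implicit Defensive.

Import GRing.Theory.
Local Open Scope ring_scope.

(** * Rows of elements, quotients and reduced products *)

(** Up to natural isomorphism the functor is a pp-functor [G]. Elements of [G M], the action of S on
    them and equations between them are then pp-conditions on tuples from [M], and homomorphisms
    preserve pp-conditions. Two finiteness principles are combined.

    The first is descent to [X]: members of the definable closure satisfy [factors_through]
    ([definable_closure_factors]), so a finite pp-system solvable in such a module comes from a
    solution in some [Y] in [X] ([finite_system_stage]). Used in the target [N], it reduces a map
    out of [G M], with [M] in [X], to a map between values of [G] on [X], where fullness is assumed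
    ([full_from_finite]). Used in the source [M], it lifts [g] over each finite part of [M].

    The second is compactness: a pure-injective module solves a system all of whose finite parts are
    solvable ([reduced_power_retraction]). This glues the partial lifts into one homomorphism
    ([full_to_pure_injective]). *)

Section RowAction.
Variable R : pzRingType.
Implicit Types M N : rmod R.

Lemma linear_of_fun M N (f : M -> N) :
  (forall (a : R^c) x y, f (a *: x + y) = a *: f x + f y) ->
  exists g : {linear M -> N}, g =1 f.
Proof.
move=> fL; pose L := GRing.isLinear.Build _ M N _ f fL.
by pose g : {linear M -> N} := HB.pack f L; exists g.
Qed.

Lemma linear_inverse M N (f : {linear M -> N}) : bijective f ->
  exists g : {linear N -> M}, cancel f g /\ cancel g f.
Proof.
case=> g fK gK; have [|g' gE] := @linear_of_fun N M g; last first.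
  by exists g'; split=> x; rewrite gE.
by move=> a x y; apply: (can_inj fK); rewrite linearP !gK.
Qed.

Lemma rmulmxD M p q (x y : 'rV[M]_p) (A : 'M[R]_(p, q)) :
  rmulmx (x + y) A = rmulmx x A + rmulmx y A.
Proof.
apply/rowP=> j; rewrite !mxE -big_split; apply: eq_bigr => i _.
by rewrite /ract !mxE scalerDr.
Qed.

Lemma rmul0mx M p q (A : 'M[R]_(p, q)) : rmulmx (0 : 'rV[M]_p) A = 0.
Proof. by apply/rowP=> j; rewrite !mxE big1 // => i _; rewrite /ract mxE scaler0. Qed.

Lemma rmulmx0 M p q (x : 'rV[M]_p) : rmulmx x (0 : 'M[R]_(p, q)) = 0.
Proof. by apply/rowP=> j; rewrite !mxE big1 // => i _; rewrite /ract mxE scale0r. Qed.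

Lemma rmulmxDr M p q (x : 'rV[M]_p) (A B : 'M[R]_(p, q)) :
  rmulmx x (A + B) = rmulmx x A + rmulmx x B.
Proof.
apply/rowP=> j; rewrite !mxE -big_split; apply: eq_bigr => i _.
by rewrite /ract !mxE scalerDl.
Qed.

Lemma rmulmxA M p q r (x : 'rV[M]_p) (A : 'M[R]_(p, q)) (B : 'M[R]_(q, r)) :
  rmulmx (rmulmx x A) B = rmulmx x (A *m B).
Proof.
apply/rowP=> j; rewrite !mxE.
under eq_bigr => i _ do rewrite /ract mxE scaler_sumr.
rewrite exchange_big; apply: eq_bigr => k _; rewrite /ract mxE /=.
rewrite [X in X *: _](_ : _ = \sum_i (A k i * B i j : R^c)) //.
by rewrite scaler_suml; apply: eq_bigr => i _; rewrite scalerA.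
Qed.

Lemma rmulmxZ M p (x : 'rV[M]_p) (r : 'cV[R]_p) (a : R) :
  rmulmx x (r *m a%:M) = map_mx (fun m => ract m a) (rmulmx x r).
Proof.
rewrite -rmulmxA; apply/rowP=> j; rewrite !mxE big_ord1 !mxE !ord1 eqxx mulr1n.
by [].
Qed.

Lemma rmulmx1 M p (x : 'rV[M]_p) : rmulmx x 1%:M = x.
Proof.
apply/rowP=> j; rewrite mxE (bigD1 j) //= big1 ?addr0 => [|i ij].
  by rewrite /ract mxE eqxx scale1r.
by rewrite /ract mxE (negPf ij) scale0r.
Qed.

Lemma rmulmxN1 M p (x : 'rV[M]_p) : rmulmx x (- 1%:M) = - x.
Proof.
by apply/eqP; rewrite -addr_eq0 -[X in _ + X]rmulmx1 -rmulmxDr addNr rmulmx0.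
Qed.

Lemma rmul_row_col M p1 p2 q (x : 'rV[M]_p1) (y : 'rV[M]_p2)
    (A : 'M[R]_(p1, q)) (B : 'M[R]_(p2, q)) :
  rmulmx (row_mx x y) (col_mx A B) = rmulmx x A + rmulmx y B.
Proof.
apply/rowP=> j; rewrite !mxE big_split_ord /=; congr (_ + _);
  by apply: eq_bigr => i _; rewrite ?row_mxEl ?row_mxEr ?col_mxEu ?col_mxEd.
Qed.

Lemma rmul_mx_row M p q1 q2 (x : 'rV[M]_p) (A : 'M[R]_(p, q1))
    (B : 'M[R]_(p, q2)) :
  rmulmx x (row_mx A B) = row_mx (rmulmx x A) (rmulmx x B).
Proof.
apply/rowP=> j; rewrite mxE -(splitK j); case: (split j) => i /=;
  rewrite ?row_mxEl ?row_mxEr mxE; apply: eq_bigr => k _;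
  by rewrite ?row_mxEl ?row_mxEr.
Qed.

End RowAction.

Section Modules.
Variable R : pzRingType.

Section QuotientModule.
Variables (V : rmod R) (P : V -> Prop).
Hypothesis P0 : P 0.
Hypothesis PZD : forall (a : R^c) x y, P x -> P y -> P (a *: x + y).

Let Pb : {pred V} := fun x => `[< P x >].
Let PB x y : P x -> P y -> P (x - y).
Proof. by move=> Hx Hy; rewrite -scaleN1r addrC; apply: PZD. Qed.
Fact quot_pred_zmod : zmod_closed Pb.
Proof.
by split=> [|x y /asboolP Hx /asboolP Hy]; apply/asboolP => //; apply: PB.
Qed.
HB.instance Definition _ := GRing.isZmodClosed.Build V Pb quot_pred_zmod.

Definition quot_module : Type := Quotient.quot Pb.
HB.instance Definition _ := GRing.Zmodule.on quot_module.
Local Notation Q := quot_module.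
Let pi (x : V) : Q := (\pi_(Quotient.quot Pb) x)%qT.
Let piB x y : pi (x - y) = pi x - pi y.
Proof. exact: raddfB. Qed.
Let piE x y : pi x = pi y <-> P (x - y).
Proof.
split=> [/eqP|H].
  by rewrite /pi -Quotient.idealrBE => /asboolP.
by apply/eqP; rewrite /pi -Quotient.idealrBE; apply/asboolP.
Qed.
Let rep (u : Q) : V := repr (u : Quotient.quot Pb).
Let piK u : pi (rep u) = u. Proof. by rewrite /pi /rep reprK. Qed.

Definition quot_scale (a : R^c) (u : Q) : Q := pi (a *: rep u).
Let quot_scaleE a x : quot_scale a (pi x) = pi (a *: x).
Proof.
apply/piE; rewrite -scalerBr -[X in P X]addr0; apply: PZD => //.
by apply/piE; rewrite piK.
Qed.
Let piD x y : pi (x + y) = pi x + pi y.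
Proof. exact: raddfD. Qed.
Fact quot_scaleA a b u : quot_scale a (quot_scale b u) = quot_scale (a * b) u.
Proof. by rewrite -[u]piK !quot_scaleE scalerA. Qed.
Fact quot_scale1 : left_id 1 quot_scale.
Proof. by move=> u; rewrite -[u]piK quot_scaleE scale1r. Qed.
Fact quot_scaleDr : right_distributive quot_scale +%R.
Proof.
by move=> a u v; rewrite -[u]piK -[v]piK -piD !quot_scaleE scalerDr piD.
Qed.
Fact quot_scaleDl u : {morph quot_scale^~ u : a b / a + b}.
Proof. by move=> a b; rewrite -[u]piK !quot_scaleE scalerDl piD. Qed.
HB.instance Definition _ := GRing.Zmodule_isLmodule.Build R^c Q
  quot_scaleA quot_scale1 quot_scaleDr quot_scaleDl.

Lemma quotient_module : exists (W : rmod R) (f : {linear V -> W}),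
  (forall w, exists v, w = f v) /\ (forall v, f v = 0 <-> P v).
Proof.
have [a x y|f fE] := @linear_of_fun R V Q pi.
  by rewrite piD -quot_scaleE.
exists (Q : rmod R), f; split=> [w|v]; first by exists (rep w); rewrite fE piK.
have -> : 0 = pi 0 by rewrite -[X in pi X](subrr 0) piB subrr.
by rewrite fE piE subr0.
Qed.

End QuotientModule.

Section ProductModule.
Variables (I : Type) (M : I -> rmod R).

Definition dprod := forall i, M i.
HB.instance Definition _ := gen_eqMixin dprod.
HB.instance Definition _ := gen_choiceMixin dprod.
Implicit Types f g : dprod.
Let dadd f g : dprod := fun i => f i + g i.
Let dopp f : dprod := fun i => - f i.
Let dzero : dprod := fun i => 0.
Let dscale (a : R^c) f : dprod := fun i => a *: f i.
Fact dprod_addA : associative dadd.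
Proof. by move=> f g h; apply: functional_extensionality_dep => i; apply: addrA. Qed.
Fact dprod_addC : commutative dadd.
Proof. by move=> f g; apply: functional_extensionality_dep => i; apply: addrC. Qed.
Fact dprod_add0 : left_id dzero dadd.
Proof. by move=> f; apply: functional_extensionality_dep => i; apply: add0r. Qed.
Fact dprod_addN : left_inverse dzero dopp dadd.
Proof. by move=> f; apply: functional_extensionality_dep => i; apply: addNr. Qed.
HB.instance Definition _ := GRing.isZmodule.Build dprod
  dprod_addA dprod_addC dprod_add0 dprod_addN.
Fact dprod_scaleA a b f : dscale a (dscale b f) = dscale (a * b) f.
Proof. by apply: functional_extensionality_dep => i; apply: scalerA. Qed.
Fact dprod_scale1 : left_id 1 dscale.
Proof. by move=> f; apply: functional_extensionality_dep => i; apply: scale1r. Qed.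
Fact dprod_scaleDr : right_distributive dscale +%R.
Proof. by move=> a f g; apply: functional_extensionality_dep => i; apply: scalerDr. Qed.
Fact dprod_scaleDl f : {morph dscale^~ f : a b / a + b}.
Proof. by move=> a b; apply: functional_extensionality_dep => i; apply: scalerDl. Qed.
HB.instance Definition _ := GRing.Zmodule_isLmodule.Build R^c dprod
  dprod_scaleA dprod_scale1 dprod_scaleDr dprod_scaleDl.

Definition dprod_proj i (f : dprod) : M i := f i.
Fact dprod_proj_linear i : linear (dprod_proj i).
Proof. by []. Qed.
HB.instance Definition _ i := GRing.isLinear.Build R^c dprod (M i) _
  (dprod_proj i) (dprod_proj_linear i).

End ProductModule.

Section Directed.
Variables (I : Type) (le : I -> I -> Prop).
Hypothesis le_dir : directed le.

Definition eventually (P : I -> Prop) := exists i0, forall i, le i0 i -> P i.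

Lemma eventually_and P Q :
  eventually P -> eventually Q -> eventually (fun i => P i /\ Q i).
Proof.
case: le_dir => _ _ le_trans le_ub [i Hi] [j Hj].
have [k [ik jk]] := le_ub i j; exists k => l kl.
by split; [apply: Hi | apply: Hj]; apply: le_trans kl.
Qed.

Lemma eventually_forall n (P : 'I_n -> I -> Prop) :
  (forall j, eventually (P j)) -> eventually (fun i => forall j, P j i).
Proof.
elim: n P => [|n IHn] P HP.
  by case: le_dir => [[i0] _ _ _]; exists i0 => i _ [].
have [i0 Hi0] := eventually_and (HP ord0) (IHn _ (fun j => HP (lift ord0 j))).
exists i0 => i /Hi0[Hi Hi'] j.
by case: (unliftP ord0 j) => [j'|] ->; [apply: Hi' | apply: Hi].
Qed.

Lemma eventually_ex (P : I -> Prop) : eventually P -> exists i, P i.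
Proof. by case: le_dir => _ le_refl _ _ [i Hi]; exists i; apply: Hi. Qed.

End Directed.

Section ReducedProduct.
Variables (I : Type) (le : I -> I -> Prop) (M : I -> rmod R).
Hypothesis le_dir : directed le.

(* The quotient of the product by the families vanishing on a tail of I; the  *)
(* last clause is the analogue of Los's theorem for pp-formulas.              *)
Lemma reduced_product : exists (B : rmod R) (c : {linear dprod M -> B}),
  [/\ forall b, exists f, b = c f,
      forall f g, c f = c g <-> eventually le (fun i => f i = g i)
    & forall n (phi : pp_formula R n) (z : 'rV[dprod M]_n),
        pp_sol phi (map_mx c z) <->
        eventually le (fun i => pp_sol phi (map_mx (dprod_proj i) z))].
Proof.
pose P (f : dprod M) := eventually le (fun i => f i = 0).
have P0 : P 0 by case: le_dir => [[i0] _ _ _]; exists i0.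
have PZD (a : R^c) f g : P f -> P g -> P (a *: f + g).
  move=> Pf Pg; have [i0 Hi0] := eventually_and le_dir Pf Pg.
  exists i0 => i /Hi0[fi gi].
  have -> : (a *: f + g) i = a *: f i + g i by [].
  by rewrite fi gi scaler0 addr0.
have [B [c [c_surj c0]]] := quotient_module P0 PZD.
have cE f g : c f = c g <-> eventually le (fun i => f i = g i).
  split=> [|[i0 Hi0]].
    move/eqP; rewrite -subr_eq0 -linearB => /eqP/c0[i0 Hi0].
    by exists i0 => i /Hi0/eqP; rewrite subr_eq0 => /eqP.
  apply/eqP; rewrite -subr_eq0 -linearB; apply/eqP/c0.
  by exists i0 => i /Hi0 fg; apply/eqP; rewrite subr_eq0 fg.
have solE p q (A : 'M[R]_(p, q)) (z : 'rV[dprod M]_p) :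
    rmulmx (map_mx c z) A = 0 <->
    eventually le (fun i => rmulmx (map_mx (dprod_proj i) z) A = 0).
  rewrite rmulmx_map; split=> [E|[i0 Hi0]].
    have /(eventually_forall le_dir)[i0 Hi0] : forall j : 'I_q, eventually le
        (fun i => rmulmx z A 0 j i = 0).
      move=> j; apply/(cE _ 0); move/rowP/(_ j): E.
      by rewrite !mxE linear0.
    exists i0 => i /Hi0 Hi; rewrite rmulmx_map.
    by apply/rowP=> j; rewrite mxE [RHS]mxE; apply: Hi.
  apply/rowP=> j; rewrite mxE [RHS]mxE -(linear0 c); apply/cE.
  by exists i0 => i /Hi0; rewrite rmulmx_map => /rowP/(_ j); rewrite !mxE.
exists B, c; split=> // n phi z; split=> [[y]|[i0 Hi0]].
  have [y' ->] : exists y', y = map_mx c y'.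
    have [s sE] := choice c_surj; exists (map_mx s y).
    by apply/rowP=> j; rewrite !mxE -sE.
  rewrite -map_row_mx => /solE[i0 Hi0]; exists i0 => i /Hi0.
  by rewrite map_row_mx; exists (map_mx (dprod_proj i) y').
(* Solutions are given only beyond [i0]; elsewhere 0 is taken, which the quotient does not see. *)
have Hy i : exists y : 'rV[M i]_(pp_ex phi),
    le i0 i -> rmulmx (row_mx (map_mx (dprod_proj i) z) y) (pp_mx phi) = 0.
  case: (pselect (le i0 i)) => [/Hi0[y Hy]|?]; first by exists y.
  by exists 0.
pose y i := projT1 (cid (Hy i)); have yP i := projT2 (cid (Hy i)).
exists (map_mx c (\row_j (fun i => y i 0 j : M i))).
rewrite -map_row_mx; apply/solE; exists i0 => i /yP <-.
by rewrite map_row_mx; congr (rmulmx (row_mx _ _) _); apply/rowP=> j; rewrite !mxE.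
Qed.

End ReducedProduct.
End Modules.

(** * Presentations, purity and direct limits *)

Section Presentations.
Variable R : pzRingType.
Implicit Types M N L : rmod R.

(** The body of [finitely_presented] with the generators and relations kept as parameters. *)
Definition presents n k (A : 'M[R]_(n, k)) M (x : 'rV[M]_n) :=
  [/\ forall m : M, exists r : 'cV[R]_n, rmulmx x r = const_mx m,
      rmulmx x A = 0
    & forall r : 'cV[R]_n, rmulmx x r = 0 ->
        exists s : 'cV[R]_k, r = A *m s].

Lemma eq_on_generators n k (A : 'M[R]_(n, k)) M (x : 'rV[M]_n) L
    (f g : {linear M -> L}) :
  presents A x -> map_mx f x = map_mx g x -> f =1 g.
Proof.
case=> gen _ _ fg m; have [r xr] := gen m.
have /rowP/(_ 0) : map_mx f (rmulmx x r) = map_mx g (rmulmx x r).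
  by rewrite -!rmulmx_map fg.
by rewrite xr !mxE.
Qed.

Lemma linear_of_generators n k (A : 'M[R]_(n, k)) M (x : 'rV[M]_n) L
    (w : 'rV[L]_n) :
  presents A x -> rmulmx w A = 0 -> exists t : {linear M -> L}, map_mx t x = w.
Proof.
case=> gen _ rel wA; have [r rE] := choice gen.
pose t m := rmulmx w (r m) 0 0.
(* The value does not depend on the chosen coefficients: two choices differ by a combination of the
   columns of [A], which [w] kills. *)
have tE m (s : 'cV[R]_n) : rmulmx x s = const_mx m -> rmulmx w s = const_mx (t m).
  move=> xs; have [s' E] : exists s' : 'cV[R]_k, s + r m *m (- 1)%:M = A *m s'.
    apply: rel; rewrite rmulmxDr rmulmxZ xs rE.
    by apply/rowP=> j; rewrite !mxE /ract scaleN1r subrr.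
  have /rowP/(_ 0) : rmulmx w (s + r m *m (- 1)%:M) = 0.
    by rewrite E -rmulmxA wA rmul0mx.
  rewrite rmulmxDr rmulmxZ !mxE /ract scaleN1r => /eqP; rewrite subr_eq0 => /eqP E'.
  by apply/rowP=> j; rewrite ord1 !mxE E' /t mxE.
have [a m m'|t' t'E] := @linear_of_fun R M L t.
  have /(tE (a *: m + m'))/rowP/(_ 0) :
      rmulmx x (r m *m (a : R)%:M + r m') = const_mx (a *: m + m').
    by rewrite rmulmxDr rmulmxZ !rE; apply/rowP=> j; rewrite !mxE.
  by rewrite rmulmxDr rmulmxZ !mxE => <-; rewrite /t !mxE.
exists t'; apply/rowP=> j; rewrite mxE t'E.
have /(tE (x 0 j))/rowP/(_ 0) :
    rmulmx x (delta_mx j 0 : 'cV[R]_n) = const_mx (x 0 j).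
  apply/rowP=> l; rewrite !mxE (bigD1 j) //= big1 ?addr0 => [|i ij].
    by rewrite /ract mxE eqxx ord1 eqxx scale1r.
  by rewrite /ract mxE (negPf ij) scale0r.
rewrite !mxE => <-; rewrite (bigD1 j) //= big1 ?addr0 => [|i ij].
  by rewrite /ract mxE eqxx scale1r.
by rewrite /ract mxE (negPf ij) scale0r.
Qed.

Lemma cokernel_presented n k (A : 'M[R]_(n, k)) :
  exists (M : rmod R) (x : 'rV[M]_n), presents A x.
Proof.
pose V : rmod R := 'cV[R^c]_n.
pose P (v : V) := exists s : 'cV[R]_k, (v : 'cV[R]_n) = A *m s.
have P0 : P 0 by exists 0; rewrite mulmx0.
have scaleE (a : R^c) (v : V) :
    (a *: v : V) = ((v : 'cV[R]_n) *m (a : R)%:M : 'cV[R]_n).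
  by apply/colP=> i; rewrite !mxE big_ord1 !mxE eqxx mulr1n.
have PZD (a : R^c) (v w : V) : P v -> P w -> P (a *: v + w).
  case=> s vE [t wE]; exists (s *m (a : R)%:M + t).
  by rewrite mulmxDr mulmxA -vE -wE -scaleE.
have [M [f [f_surj f0]]] := quotient_module P0 PZD.
pose x : 'rV[M]_n := \row_j f (delta_mx j 0 : 'cV[R]_n).
have xE (r : 'cV[R]_n) : rmulmx x r = const_mx (f r).
  apply/rowP=> j; rewrite !mxE.
  have -> : f r = f (\sum_i (r i 0 : R^c) *: (delta_mx i 0 : V)).
    congr (f _); apply/colP=> i; rewrite summxE (bigD1 i) //= big1 ?addr0.
      by rewrite !mxE !eqxx mulr1.
    by move=> l li; rewrite !mxE eq_sym (negPf li) mulr0.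
  rewrite linear_sum; apply: eq_bigr => i _.
  by rewrite /ract mxE linearZ_LR ord1.
exists M, x; split=> [m||r].
- by have [v ->] := f_surj m; exists v; apply: xE.
- apply/rowP=> j; rewrite [RHS]mxE.
  have /f0 : P (col j A : 'cV[R]_n).
    by exists (delta_mx j 0); rewrite colE.
  have /rowP/(_ 0) := xE (col j A); rewrite [RHS]mxE => fE f_eq0.
  rewrite -[RHS]f_eq0 -fE !mxE.
  by apply: eq_bigr => i _; rewrite !mxE.
- by rewrite xE => /rowP/(_ 0); rewrite !mxE => /f0.
Qed.

(** Only the universal property of [P] is available, so elements of [P] are turned into maps from
    the free module of rank one, the cokernel of a matrix without columns. *)
Lemma is_product_inj (I : Type) (M : I -> rmod R) (P : rmod R)
    (p : forall i, {linear P -> M i}) (x y : P) :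
  is_product p -> (forall i, p i x = p i y) -> x = y.
Proof.
move=> prod_p xy; have [F [e eF]] := cokernel_presented (0 : 'M[R]_(1, 0)).
have hom (z : P) : exists t : {linear F -> P}, t (e 0 0) = z.
  have [|t tE] := linear_of_generators (w := const_mx z : 'rV[P]_1) eF.
    by rewrite rmulmx0.
  by exists t; move/rowP/(_ 0): tE; rewrite !mxE.
have [tx txE] := hom x; have [ty tyE] := hom y.
rewrite -txE -tyE in xy *.
have [h [_ h_uniq]] := prod_p F (fun i => p i \o tx : {linear F -> M i}).
rewrite (h_uniq tx) // (h_uniq ty) // => i.
apply: (eq_on_generators eF); apply/rowP=> j.
by rewrite ord1 !mxE /= xy.
Qed.

(** Purity speaks of pp-1-formulas only, hence an induction on the number of parameters. Quantifying
    all parameters but the first gives a solution [(z', y1)] in [M]; subtracting it leaves a system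
    in the remaining parameters, shifted by [z']. *)
Lemma pure_solution (M N : rmod R) (i : {linear M -> N}) n k q
    (D : 'M[R]_(n, q)) (E : 'M[R]_(k, q)) (z : 'rV[M]_n) :
  pure_embedding i ->
  (exists y : 'rV[N]_k, rmulmx (map_mx i z) D + rmulmx y E = 0) ->
  exists y : 'rV[M]_k, rmulmx z D + rmulmx y E = 0.
Proof.
case=> i_inj i_pure; elim: n k D E z => [|n IHn] k D E z.
  exists 0; rewrite rmul0mx addr0.
  by apply/rowP=> j; rewrite !mxE big_ord0.
move: D z; rewrite -[n.+1]/(1 + n)%N => D z [y].
rewrite -[z in X in X -> _]hsubmxK -[D in X in X -> _]vsubmxK.
rewrite map_row_mx rmul_row_col -addrA -rmul_row_col => Ny.
pose phi := PPFormula (col_mx (usubmx D) (col_mx (dsubmx D) E) : 'M_(1 + (n + k), q)).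
have lsubE : lsubmx z = const_mx (z 0 0).
  by apply/rowP=> j; rewrite !mxE; congr (z _ _); apply/val_inj; case: j => [[]].
have [a [y' My'] aE] : exists2 a, pp_sol phi (const_mx a : 'rV_1) & i (z 0 0) = i a.
  apply/i_pure; split; last by exists (z 0 0).
  exists (row_mx (map_mx i (rsubmx z)) y); rewrite /= rmul_row_col -[RHS]Ny.
  by rewrite lsubE map_const_mx.
move: My'; rewrite -(i_inj _ _ aE) -lsubE /= -[y']hsubmxK !rmul_row_col.
set z' := lsubmx y'; set y1 := rsubmx y' => My'.
have [|y2 Hy2] := IHn k (dsubmx D) E (rsubmx z - z').
  exists (y - map_mx i y1); rewrite map_mxB !rmulmxB.
  have NE : rmulmx (map_mx i (lsubmx z)) (usubmx D) +
    (rmulmx (map_mx i z') (dsubmx D) + rmulmx (map_mx i y1) E) = 0.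
    by rewrite !rmulmx_map -!map_mxD My' map_mx0.
  rewrite addrACA -opprD.
  move: Ny; rewrite rmul_row_col => Ny.
  by have /addrI -> := etrans Ny (esym NE); rewrite subrr.
exists (y1 + y2); rewrite -[z]hsubmxK -[D]vsubmxK rmul_row_col rmulmxD.
rewrite -(addrA (rmulmx (lsubmx z) _)).
have -> : rmulmx (rsubmx z) (dsubmx D) =
    rmulmx z' (dsubmx D) + rmulmx (rsubmx z - z') (dsubmx D).
  by rewrite rmulmxB addrC subrK.
by rewrite addrACA Hy2 addr0.
Qed.

(** * Elements and equations in direct limits *)

Section DirectLimits.
Variables (I : Type) (le : I -> I -> Prop) (M : I -> rmod R).
Variables (f : forall i j, le i j -> {linear M i -> M j}).
Variables (L : rmod R) (u : forall i, {linear M i -> L}).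
Hypotheses (f_sys : direct_system f) (u_lim : is_direct_limit f u).

Let le_dir : directed le. Proof. by case: f_sys. Qed.

(** The images of the [u i] form a submodule; the quotient map by it and 0 agree on every [M i], so
    they are equal by uniqueness. *)
Lemma direct_limit_surj (l : L) : exists i m, l = u i m.
Proof.
have [[i0] le_refl le_trans le_ub] := le_dir.
have [u_f u_univ] := u_lim.
pose P l := exists i m, l = u i m.
have P0 : P 0 by exists i0, 0; rewrite linear0.
have PZD (a : R^c) x y : P x -> P y -> P (a *: x + y).
  move=> [i [m ->]] [j [m' ->]]; have [k [ik jk]] := le_ub i j.
  exists k, (a *: f ik m + f jk m'); rewrite linearP.
  by have /= -> := u_f _ _ ik m; have /= -> := u_f _ _ jk m'.
have [W [c [_ c0]]] := quotient_module P0 PZD.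
have [i j h x //|w [_ w_uniq]] := u_univ W (fun i => \0 : {linear M i -> W}).
apply/c0; rewrite (w_uniq c).
  by rewrite -(w_uniq (\0 : {linear L -> W})).
by move=> i m /=; apply/c0; exists i, m.
Qed.

(** The reduced product serves as a test cocone: sending [m] to the family of its images [f h m],
    with 0 where there is no transition map, factors through [L], and a family is zero there exactly
    when it vanishes on a tail. *)
Lemma direct_limit_eq0 i (m : M i) : u i m = 0 ->
  eventually le (fun j => forall h : le i j, f h m = 0).
Proof.
have [_ le_refl le_trans le_ub] := le_dir.
have [_ f_id f_comp] := f_sys; have [u_f u_univ] := u_lim => um.
have [B [c [_ cE _]]] := reduced_product M le_dir.
pose push i (m : M i) : dprod M :=
  fun j => if pselect (le i j) is left h then f h m else 0.
have pushE j k (h : le j k) x : push j x k = f h x.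
  by rewrite /push; case: pselect => // h'; congr (f _ x); apply: Prop_irrelevance.
have Hv j : exists v : {linear M j -> B}, v =1 c \o push j.
  apply: linear_of_fun => a x y /=; rewrite -linearP; congr (c _).
  apply: functional_extensionality_dep => k; rewrite /push.
  have -> : forall g h : dprod M, (a *: g + h) k = a *: g k + h k by [].
  by case: pselect => h; rewrite ?linearP // scaler0 addr0.
pose v j := projT1 (cid (Hv j)); have vE j := projT2 (cid (Hv j)).
have [j k h x|w [wu _]] := u_univ B v.
  rewrite /= (vE k) (vE j) /=; apply/cE; exists k => l kl.
  by rewrite !(pushE _ _ kl) (pushE _ _ (le_trans _ _ _ h kl)); apply: f_comp.
have wuE x : c (push i x) = w (u i x).
  by rewrite [LHS](esym (vE i x)); symmetry; apply: wu.
have /cE[j Hj] : c (push i m) = c (push i 0) by rewrite !wuE um !linear0.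
by exists j => k /Hj E h; rewrite -(pushE _ _ h) E (pushE _ _ h) linear0.
Qed.

Lemma direct_limit_solution p q (A : 'M[R]_(p, q)) (z : 'rV[L]_p) :
  rmulmx z A = 0 ->
  exists i (z' : 'rV[M i]_p), rmulmx z' A = 0 /\ map_mx (u i) z' = z.
Proof.
have [u_f u_univ] := u_lim; have [_ _ le_trans le_ub] := le_dir.
have [_ f_id f_comp] := f_sys.
move=> zA; have [i [z0 z0E]] : exists i (z' : 'rV[M i]_p), map_mx (u i) z' = z.
  have /(eventually_forall le_dir)/(eventually_ex le_dir)[i Hi] : forall k : 'I_p,
      eventually le (fun i => exists m : M i, z 0 k = u i m).
    move=> k; have [i [m ->]] := direct_limit_surj (z 0 k).
    by exists i => j ij; exists (f ij m); symmetry; apply: u_f.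
  have [g gE] := choice Hi; exists i, (\row_k g k).
  by apply/rowP=> k; rewrite !mxE -gE.
have Hj (j : 'I_q) : eventually le (fun k => forall h : le i k,
    f h (rmulmx z0 A 0 j) = 0).
  apply: direct_limit_eq0.
  by move/rowP/(_ j): zA; rewrite -z0E rmulmx_map !mxE.
have [k0 Hk0] := eventually_forall le_dir Hj.
have [k [k0k ik]] := le_ub k0 i.
exists k, (map_mx (f ik) z0); split.
  by rewrite rmulmx_map; apply/rowP=> j; rewrite mxE (Hk0 _ k0k) mxE.
by rewrite -z0E; apply/rowP=> j; rewrite !mxE; apply: u_f.
Qed.

End DirectLimits.

End Presentations.

(** * The definable closure of a covariantly finite subcategory *)

Section LinearCombinations.
Variables (R : pzRingType) (T : eqType).
Implicit Types M : rmod R.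

Definition lin_comb M (z : T -> M) (l : seq (R * T)) : M :=
  \sum_(p <- l) ract (z p.2) p.1.

Lemma lin_comb_map M M' (f : {linear M -> M'}) z l :
  f (lin_comb z l) = lin_comb (f \o z) l.
Proof.
by rewrite linear_sum; apply: eq_bigr => p _; rewrite /ract linearZ_LR.
Qed.

Lemma eq_lin_comb M (z z' : T -> M) l :
  {in [seq p.2 | p <- l], z =1 z'} -> lin_comb z l = lin_comb z' l.
Proof.
move=> zz'; rewrite /lin_comb !big_seq; apply: eq_bigr => p lp.
by rewrite zz' //; apply: map_f.
Qed.

(* The condition that the given pp-formula holds of the row of the given      *)
(* linear combinations of variables from T.                                   *)
Record pp_cond := PPCond {
  cond_arity : nat;
  cond_pp : pp_formula R cond_arity;
  cond_term : 'I_cond_arity -> seq (R * T) }.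
Arguments cond_term : clear implicits.

Definition cond_row M (z : T -> M) (c : pp_cond) : 'rV[M]_(cond_arity c) :=
  \row_i lin_comb z (cond_term c i).

Definition cond_holds M (z : T -> M) (c : pp_cond) : Prop :=
  pp_sol (cond_pp c) (cond_row z c).

Lemma cond_row_map M M' (f : {linear M -> M'}) z c :
  map_mx f (cond_row z c) = cond_row (f \o z) c.
Proof. by apply/rowP=> j; rewrite !mxE lin_comb_map. Qed.

End LinearCombinations.
Arguments cond_term {R T} p i.

(** * Factoring maps from finitely presented modules through [X] *)

Section Factorization.
Variables (R : pzRingType) (X : rmod R -> Prop).
Hypothesis X_cf : covariantly_finite X.
Implicit Types M N Y : rmod R.

(* Every map from the cokernel of A to N factors through an object of X. *)
Definition factors_through N := forall p q (A : 'M[R]_(p, q)) (z : 'rV[N]_p),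
  rmulmx z A = 0 ->
  exists Y (u : {linear Y -> N}) (z' : 'rV[Y]_p),
    [/\ X Y, rmulmx z' A = 0 & map_mx u z' = z].

Lemma factors_through_sub N : X N -> factors_through N.
Proof.
move=> XN p q A z zA; exists N, (idfun : {linear N -> N}), z.
by rewrite map_mx_id.
Qed.

(** [w] is the image of the generators under the left approximation of the cokernel of [A]; it is a
    weakly universal solution of [A]. *)
Lemma approximation p q (A : 'M[R]_(p, q)) :
  exists Y (w : 'rV[Y]_p), [/\ X Y, rmulmx w A = 0
    & forall N (z : 'rV[N]_p), factors_through N -> rmulmx z A = 0 ->
        exists h : {linear Y -> N}, map_mx h w = z].
Proof.
have [P [x Px]] := cokernel_presented A.
have [Y [f [XY f_univ]]] : exists Y (f : {linear P -> Y}), X Y /\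
    forall (L : rmod R) (g : {linear P -> L}), X L ->
      exists h : {linear Y -> L}, h \o f =1 g.
  by apply: (cf_approx X_cf); exists p, q, A, x.
have xA : rmulmx x A = 0 by case: Px.
exists Y, (map_mx f x); split=> // [|N z NX zA].
  by rewrite rmulmx_map xA map_mx0.
have [L [u [z' [XL z'A <-]]]] := NX _ _ _ _ zA.
have [t <-] := linear_of_generators Px z'A.
have [h hf] := f_univ L t XL.
exists (u \o h : {linear Y -> N}); apply/rowP=> j; rewrite !mxE /=.
by congr (u _); apply: hf.
Qed.

(** The gain is that [Y] and [w] depend on [A] alone, so one pair serves all factors of a product at
    once. *)
Lemma factors_throughP N :
  (forall p q (A : 'M[R]_(p, q)) (z : 'rV[N]_p), rmulmx z A = 0 ->
     forall Y (w : 'rV[Y]_p), X Y -> rmulmx w A = 0 ->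
     (forall M (z' : 'rV[M]_p), factors_through M -> rmulmx z' A = 0 ->
        exists h : {linear Y -> M}, map_mx h w = z') ->
     exists h : {linear Y -> N}, map_mx h w = z) ->
  factors_through N.
Proof.
move=> NP p q A z zA; have [Y [w [XY wA w_univ]]] := approximation A.
by have [h hE] := NP _ _ _ _ zA _ _ XY wA w_univ; exists Y, h, w.
Qed.

Lemma factors_through_definable : definable factors_through.
Proof.
split=> [I M P p prod_p MX|I le M f L u f_sys u_lim MX|M N i i_pure NX];
  apply: factors_throughP => n k A z zA Y w XY wA w_univ.
- have Hh i : exists h : {linear Y -> M i}, map_mx h w = map_mx (p i) z.
    by apply: w_univ => //; rewrite rmulmx_map zA map_mx0.
  pose h i := projT1 (cid (Hh i)); have hE i := projT2 (cid (Hh i)).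
  have [g [gE _]] := prod_p Y h; exists g; apply/rowP=> j.
  apply: (is_product_inj prod_p) => i; move/rowP/(_ j): (hE i).
  by rewrite !mxE => <-; apply: gE.
- have [i [z' [z'A <-]]] := direct_limit_solution f_sys u_lim zA.
  have [h <-] := w_univ _ _ (MX i) z'A.
  by exists (u i \o h : {linear Y -> L}); apply/rowP=> j; rewrite !mxE.
(* In terms of generators [e] of [Y] with relations [D], and [w] written as [e C], a map from [Y]
   carrying [w] to [z] is a solution [y] of [y C = z], [y D = 0]. This finite linear system is
   solvable in [N], hence in the pure submodule [M]. *)
- have [m [l [D [e eD]]]] := cf_fp X_cf XY.
  have [gen eD0 _] := eD; have [r rE] := choice gen.
  pose C := \matrix_(a, j) r (w 0 j) a 0 : 'M[R]_(m, n).
  have wE : w = rmulmx e C.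
    apply/rowP=> j; move/rowP/(_ 0): (rE (w 0 j)); rewrite !mxE => <-.
    by apply: eq_bigr => a _; rewrite mxE.
  have iA : rmulmx (map_mx i z) A = 0 by rewrite rmulmx_map zA map_mx0.
  have [h hE] := w_univ _ _ NX iA.
  have [|y] := @pure_solution R M N i n m (n + l)
      (row_mx (- 1%:M) 0) (row_mx C D) z i_pure.
    exists (map_mx h e); rewrite !rmul_mx_row !rmulmx_map eD0 -wE hE.
    rewrite -!rmulmx_map rmulmx0 add_row_mx map_mx0 addr0.
    by rewrite rmulmxN1 addNr row_mx0.
  rewrite !rmul_mx_row rmulmx0 add_row_mx add0r -row_mx0 => /eq_row_mx[yC yD].
  have [g gE] := linear_of_generators eD yD.
  exists g; rewrite wE -rmulmx_map gE; apply/eqP.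
  by rewrite -subr_eq0 addrC -rmulmxN1 yC.
Qed.

Lemma definable_closure_factors N : definable_closure X N -> factors_through N.
Proof.
by apply; [exact: factors_through_definable | exact: factors_through_sub].
Qed.

(** * Descent of finite pp-systems to objects of [X] *)

Section FiniteSystems.
Variables (N : rmod R).
Hypothesis NX : factors_through N.

(** [A] presents the module obtained from [Y] by freely adjoining witnesses for [phi] at [x]; its
    map to [N] factors through some [Y'] in [X]. *)
Lemma pp_sol_stage n (phi : pp_formula R n) Y (u : {linear Y -> N})
    (x : 'rV[Y]_n) : X Y -> pp_sol phi (map_mx u x) ->
  exists Y' (u' : {linear Y' -> N}) (t : {linear Y -> Y'}),
    [/\ X Y', pp_sol phi (map_mx t x) & u' \o t =1 u].
Proof.
move=> XY [y uxy]; have [m [l [D [e eD]]]] := cf_fp X_cf XY.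
have [gen eD0 _] := eD; have [r rE] := choice gen.
pose C := \matrix_(a, j) r (x 0 j) a 0 : 'M[R]_(m, n).
have xE : x = rmulmx e C.
  apply/rowP=> j; move/rowP/(_ 0): (rE (x 0 j)); rewrite !mxE => <-.
  by apply: eq_bigr => a _; rewrite mxE.
pose A := block_mx D (C *m usubmx (pp_mx phi)) 0 (dsubmx (pp_mx phi)).
have uyA : rmulmx (row_mx (map_mx u e) y) A = 0.
  rewrite /A /block_mx rmul_row_col !rmul_mx_row add_row_mx rmulmx0 addr0.
  rewrite rmulmx_map eD0 map_mx0 -rmulmxA rmulmx_map -xE.
  by rewrite -rmul_row_col vsubmxK uxy row_mx0.
have [Y' [u' [z [XY' zA zE]]]] := NX uyA; move: zA zE.
rewrite -[z]hsubmxK map_row_mx /A /block_mx rmul_row_col !rmul_mx_row.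
rewrite add_row_mx rmulmx0 addr0 -row_mx0 => /eq_row_mx[zD zA].
case/eq_row_mx => zE _; have [t tE] := linear_of_generators eD zD.
exists Y', u', t; split=> //.
  exists (rsubmx z); rewrite -[pp_mx _]vsubmxK rmul_row_col -[RHS]zA.
  by rewrite -rmulmxA -tE (rmulmx_map t e) -xE.
apply: (eq_on_generators (f := u' \o t : {linear Y -> N}) eD).
by rewrite -zE -tE; apply/rowP=> j; rewrite !mxE.
Qed.

Lemma finite_system_stage (T J : eqType) (c : J -> pp_cond R T) (z : T -> N)
    (E : seq T) (s : seq J) :
  (forall j, j \in s -> cond_holds z (c j)) ->
  exists Y (u : {linear Y -> N}) (zY : T -> Y),
    [/\ X Y, {in E, u \o zY =1 z} & forall j, j \in s -> cond_holds zY (c j)].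
Proof.
move=> zs; pose supp j :=
  flatten [seq [seq p.2 | p <- cond_term (c j) i] | i <- enum 'I_(cond_arity (c j))].
(* The solution is controlled on [F] only, so [F] contains every variable of every condition. It
   stays fixed while the induction runs over sublists of [s]. *)
pose F := E ++ flatten [seq supp j | j <- s].
suff [Y [u [zY [XY uz zYs]]]] : exists Y (u : {linear Y -> N}) (zY : T -> Y),
    [/\ X Y, {in F, u \o zY =1 z} & forall j, j \in s -> cond_holds zY (c j)].
  by exists Y, u, zY; split=> // t Et; apply: uz; rewrite mem_cat Et.
have: {subset s <= s} by [].
elim: {-2}s => [|j s' IHs] s's.
  (* A matrix without columns presents the free module on [F]; variables outside [F] receive 0. *)
  have [|Y [u [z' [XY _ z'E]]]] :=
      NX (A := 0 : 'M_(size F, 0)) (z := \row_i z (tnth (in_tuple F) i)).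
    by rewrite rmulmx0.
  exists Y, u, (fun t => if insub (index t F) is Some i then z' 0 i else 0).
  split=> // t Ft /=; have tF : (index t F < size F)%N by rewrite index_mem.
  rewrite insubT; move/rowP/(_ (Ordinal tF)): z'E; rewrite !mxE => ->.
  by rewrite (tnth_nth t) /= nth_index.
have [j' s'j'|Y [u [zY [XY uz zYs]]]] := IHs.
  by apply: s's; rewrite inE s'j' orbT.
have sj : j \in s by apply: s's; rewrite mem_head.
have uzj : map_mx u (cond_row zY (c j)) = cond_row z (c j).
  rewrite cond_row_map; apply/rowP=> i; rewrite !mxE.
  apply: eq_lin_comb => t Ht; apply: uz; rewrite mem_cat; apply/orP; right.
  apply/flatten_mapP; exists j => //; apply/flatten_mapP; exists i => //.
  by rewrite mem_enum.
have [Y' [u' [t [XY' tj tu]]]] : exists Y' (u' : {linear Y' -> N})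
    (t : {linear Y -> Y'}),
    [/\ X Y', cond_holds (t \o zY) (c j) & u' \o t =1 u].
  have [|Y' [u' [t [XY' tj tu]]]] :=
      @pp_sol_stage _ (cond_pp (c j)) Y u (cond_row zY (c j)) XY.
    by rewrite uzj; apply: zs.
  by rewrite cond_row_map in tj; exists Y', u', t.
exists Y', u', (t \o zY); split=> // [x Fx|j'].
  by rewrite -(uz x Fx) -[RHS]tu.
rewrite inE => /predU1P[->//|/zYs H].
by rewrite /cond_holds -cond_row_map; apply: pp_sol_map.
Qed.

End FiniteSystems.
End Factorization.

(** * Fullness *)

(** The diagonal of [N] is pure in the reduced power by the analogue of Los's theorem, so it splits.
    The retraction fixes constants, hence pp-conditions with parameters [b] in [N] survive. *)
Lemma reduced_power_retraction (R : pzRingType) (I : Type) (le : I -> I -> Prop)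
    (N : rmod R) : directed le -> pure_injective N ->
  exists r : {linear dprod (fun _ : I => N) -> N},
    (forall f g, eventually le (fun i => f i = g i) -> r f = r g) /\
    (forall n (phi : pp_formula R n) (z : 'rV[dprod (fun _ : I => N)]_n)
        (b : 'rV[N]_n),
      eventually le (fun i => pp_sol phi (map_mx (dprod_proj i) z - b)) ->
      pp_sol phi (map_mx r z - b)).
Proof.
move=> le_dir N_pi.
have [B [c [_ cE solE]]] := reduced_product (fun _ : I => N) le_dir.
pose const (x : N) : dprod (fun _ : I => N) := fun => x.
have [//|diag diagE] := @linear_of_fun R N B (c \o const).
  by move=> a x y /=; rewrite -linearP.
have diag_pure : pure_embedding diag.
  split=> [x y|phi b].
    by rewrite !diagE => /cE/(eventually_ex le_dir)[].
  split=> [[Hb [a bE]]|[a Ha ->]]; last first.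
    by split; [rewrite -map_const_mx; apply: pp_sol_map | exists a].
  exists a => //; move: Hb; rewrite bE diagE /= -map_const_mx.
  by move=> /solE/(eventually_ex le_dir)[i]; rewrite map_const_mx.
have [r rK] := N_pi B diag diag_pure.
exists (r \o c : {linear _ -> N}); split=> [f g fg|n phi z b Hz].
  by rewrite /=; congr (r _); apply/cE.
have -> : map_mx (r \o c) z - b = map_mx r (map_mx c (z - map_mx const b)).
  by apply/rowP=> j; rewrite !mxE linearB /= linearB -[c (const _)]diagE rK.
apply: pp_sol_map; apply/solE; case: Hz => i0 Hi0; exists i0 => i /Hi0.
by congr (pp_sol _ _); apply/rowP=> j; rewrite !mxE.
Qed.

Lemma pp_val_sum (R : pzRingType) n (phi : pp_formula R n) (M : rmod R)
    (I : finType) (F : I -> pp_group phi M) :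
  \sum_i F i = \sum_i (F i : 'rV[M]_n) :> 'rV[M]_n.
Proof. exact: (big_morph (@pp_val R n phi M)). Qed.

(** * Lifting maps along a pp-functor *)

Section PPFunctor.
Variables (R S : pzRingType) (X : rmod R -> Prop) (D : rmod S -> Prop).
Hypothesis X_cf : covariantly_finite X.
Local Notation C := (definable_closure X).
Variable d : pp_interpretation C D.
Local Notation G := (pp_functor d).
Local Notation phi := (pp_num d).
Local Notation psi := (pp_den d).
Local Notation rho := (pp_rho d).
Implicit Types M N : obj C.

Definition cls (M : obj C) (a : pp_group phi M) : G M := pp_class psi a.

Lemma cls_is_additive M : zmod_morphism (@cls M).
Proof. exact: pp_class_additive. Qed.
HB.instance Definition _ M := GRing.isZmodMorphism.Build _ _ (@cls M)
  (@cls_is_additive M).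

Lemma cls_surj M (u : G M) : exists a, u = cls a.
Proof. exact: (@pp_class_surj R _ phi psi M u). Qed.

Lemma cls_eq M (a b : pp_group phi M) :
  cls a = cls b <-> pp_sol psi ((a : 'rV[M]_(pp_arity d)) - (b : 'rV[M]_(pp_arity d))).
Proof. exact: pp_class_eq. Qed.

Lemma cls_act M (s : S) (u v : G M) : ract u s = v <->
  exists a b : pp_group phi M, [/\ u = cls a, v = cls b
    & pp_sol (rho s) (row_mx (a : 'rV[M]_(pp_arity d)) (b : 'rV[M]_(pp_arity d)))].
Proof.
exact: iff_sym (@pp_actP R S d M (pp_iacts d (objP M)) s u v).
Qed.

Lemma cls_map (M N : obj C) (f : {linear M -> N}) (a : pp_group phi M) :
  fmap G f (cls a) = cls (pp_group_map f a).
Proof. exact: pp_module_mapE. Qed.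

Lemma pp_group_of_sol (M : obj C) (x : 'rV[M]_(pp_arity d)) :
  pp_sol phi x -> exists a : pp_group phi M, a = x :> 'rV[M]_(pp_arity d).
Proof.
move=> phix; have Hx : pp_pred phi x by apply/asboolP.
by exists (PPGroup Hx).
Qed.

Hypothesis G_full : forall M N : obj C, X M -> X N ->
  forall g : {linear G M -> G N}, exists f : {linear M -> N}, fmap G f =1 g.

Lemma full_from_finite (M N : obj C) (g : {linear G M -> G N}) :
  X M -> finitely_presented (G M) ->
  exists f : {linear M -> N}, fmap G f =1 g.
Proof.
move=> XM [n [k [A [x xA]]]]; have [gen xA0 _] := xA.
have NX : factors_through X N.
  exact: (definable_closure_factors X_cf (objP N)).
have [c cE] := choice (fun j => cls_surj (g (x 0 j))).
have /choice[a /choice[b abE]] := fun jl : 'I_n * 'I_k =>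
  (@cls_act N (A jl.1 jl.2) (g (x 0 jl.1)) _).1 erefl.
pose m := pp_arity d.
pose W : finType := ('I_n + ('I_n * 'I_k + 'I_n * 'I_k))%type.
pose T : finType := (W * 'I_m)%type.
pose J : finType := (W + (('I_n * 'I_k) + (('I_n * 'I_k) + 'I_k)))%type.
pose vc j : W := inl j; pose va jl : W := inr (inl jl).
pose vb jl : W := inr (inr jl).
pose elt w : pp_group phi N :=
  match w with inl j => c j | inr (inl jl) => a jl | inr (inr jl) => b jl end.
pose z (t : T) : N := (elt t.1 : 'rV[N]_m) 0 t.2.
pose Z (P : rmod R) (z : T -> P) w : 'rV[P]_m := \row_i z (w, i).
(* The conditions make the classes of the [c j] satisfy the relations [A]: all tuples lie in [phi];
   [a] represents the class of [c]; [rho] takes [a] to [b]; each column of [b] sums into [psi]. The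
   tuple [a] is needed because the action is witnessed on some representative, not necessarily on
   [c]. *)
pose cond (j : J) : pp_cond R T :=
  match j with
  | inl w => PPCond phi (fun i => [:: (1, (w, i))])
  | inr (inl jl) => PPCond psi (fun i => [:: (1, (vc jl.1, i)); (-1, (va jl, i))])
  | inr (inr (inl jl)) => PPCond (rho (A jl.1 jl.2)) (fun i =>
      match split i with
      | inl i' => [:: (1, (va jl, i'))]
      | inr i' => [:: (1, (vb jl, i'))]
      end)
  | inr (inr (inr l)) => PPCond psi (fun i =>
      [seq (1, (vb (j, l), i)) | j <- index_enum 'I_n])
  end.
have condE (P : rmod R) (y : T -> P) j : cond_holds y (cond j) <->
  match j with
  | inl w => pp_sol phi (Z P y w)
  | inr (inl jl) => pp_sol psi (Z P y (vc jl.1) - Z P y (va jl))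
  | inr (inr (inl jl)) =>
      pp_sol (rho (A jl.1 jl.2)) (row_mx (Z P y (va jl)) (Z P y (vb jl)))
  | inr (inr (inr l)) => pp_sol psi (\sum_j Z P y (vb (j, l)))
  end.
  suff E : cond_row y (cond j) = match j return 'rV[P]_(cond_arity (cond j)) with
    | inl w => Z P y w
    | inr (inl jl) => Z P y (vc jl.1) - Z P y (va jl)
    | inr (inr (inl jl)) => row_mx (Z P y (va jl)) (Z P y (vb jl))
    | inr (inr (inr l)) => \sum_j Z P y (vb (j, l))
    end by rewrite /cond_holds E; case: j {E} => [w|[jl|[jl|l]]].
  apply/rowP; case: j => [w|[jl|[jl|l]]] i /=; rewrite mxE /lin_comb /=.
  - by rewrite big_seq1 mxE /ract scale1r.
  - by rewrite big_cons big_seq1 !mxE /ract scale1r scaleN1r.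
  - by rewrite mxE; case: split => i'; rewrite big_seq1 mxE /ract scale1r.
  - by rewrite big_map summxE; apply: eq_bigr => j _; rewrite mxE /ract scale1r.
have zE w : Z N z w = elt w by apply/rowP=> i; rewrite mxE.
have b_sum l : \sum_j cls (b (j, l)) = 0.
  transitivity (rmulmx (map_mx g x) A 0 l); last first.
    by rewrite rmulmx_map xA0 !mxE linear0.
  by rewrite mxE; apply: eq_bigr => j _; rewrite mxE; case: (abE (j, l)).
have [j _|Y [u [y [XY uy yP]]]] :=
    finite_system_stage X_cf NX (c := cond) (z := z) (enum T) (s := enum J).
  apply/condE; case: j => [w|[jl|[jl|l]]]; rewrite ?zE.
  - exact: pp_groupP.
  - by apply/cls_eq; rewrite /= -cE; case: (abE jl).
  - by case: (abE jl).
  - have /cls_eq : cls (\sum_j b (j, l)) = cls 0 by rewrite raddf_sum b_sum raddf0.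
    rewrite /= subr0; congr (pp_sol _ _).
    by rewrite pp_val_sum; apply: eq_bigr => j _; rewrite zE.
have YC : C Y by move=> C' _; apply.
pose Yo := Obj YC.
have HY w := pp_group_of_sol (M := Yo) ((condE _ y (inl w)).1 (yP _ (mem_enum _ _))).
have [q qE] := choice HY.
have uq w : pp_group_map u (q w) = elt w.
  apply/val_inj; rewrite /= qE -zE; apply/rowP=> i; rewrite !mxE.
  by apply: uy; rewrite mem_enum.
have q_act jl : ract (cls (q (vc jl.1))) (A jl.1 jl.2) = cls (q (vb jl)).
  apply/cls_act; exists (q (va jl)), (q (vb jl)); split=> //.
    by apply/cls_eq; rewrite !qE; apply: (condE _ y (inr (inl jl))).1;
      apply: yP; rewrite mem_enum.
  by rewrite !qE; apply: (condE _ y (inr (inr (inl jl)))).1;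
    apply: yP; rewrite mem_enum.
have [|t tE] := linear_of_generators (w := \row_j cls (q (vc j))) xA.
  apply/rowP=> l; rewrite !mxE.
  transitivity (\sum_j cls (q (vb (j, l)))).
    by apply: eq_bigr => j _; rewrite mxE (q_act (j, l)).
  rewrite -raddf_sum -[RHS](raddf0 (@cls Yo)); apply/cls_eq.
  rewrite /= subr0.
  rewrite pp_val_sum (eq_bigr _ (fun j _ => qE (vb (j, l)))).
  by apply: (condE _ y (inr (inr (inr l)))).1; apply: yP; rewrite mem_enum.
have [f fE] := G_full XM (XY : X Yo) t.
exists (u \o f : {linear M -> N}).
apply: (eq_on_generators xA); apply/rowP=> j; rewrite !mxE.
transitivity (@fmap _ _ _ _ G Yo N u (fmap G f (x 0 j))).
  exact: (@fmap_comp _ _ _ _ G M Yo N u f).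
rewrite fE.
by move/rowP/(_ j): tE; rewrite !mxE => ->; rewrite cls_map uq cE.
Qed.

Definition zero_pp : pp_formula R 1 :=
  @PPFormula R 1 0 1 (col_mx 1%:M (0 : 'M[R]_(0, 1))).

Lemma zero_ppP (P : rmod R) (x : 'rV[P]_1) : pp_sol zero_pp x <-> x = 0.
Proof.
split=> [[y]|->]; rewrite /= ?rmul_row_col ?rmulmx1 ?rmulmx0 ?addr0 //.
by exists 0; rewrite /= rmul_row_col rmulmx0 rmul0mx addr0.
Qed.

Lemma full_to_pure_injective (M N : obj C) (g : {linear G M -> G N}) :
  (forall P : obj C, X P -> finitely_presented (G P)) -> pure_injective N ->
  exists h : {linear M -> N}, fmap G h =1 g.
Proof.
move=> G_fp N_pi; pose m := pp_arity d.
have MX : factors_through X M.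
  exact: (definable_closure_factors X_cf (objP M)).
have [c cE] := choice (fun b => cls_surj (g (cls b))).
pose K : eqType := (R^c * M * M + pp_group phi M)%type.
(* The variables are the elements of [M]. [cond] records what holds in [M] itself, solved there by
   the identity, while [solves] is what is asked of the lift. *)
pose cond (k : K) : pp_cond R M :=
  match k with
  | inl (a, x, y) => PPCond zero_pp (fun=> [:: (1, a *: x + y); (- a, x); (-1, y)])
  | inr b => PPCond phi (fun i => [:: (1, (b : 'rV[M]_m) 0 i)])
  end.
pose solves (h : M -> N) (k : K) :=
  match k with
  | inl (a, x, y) => h (a *: x + y) = a *: h x + h y
  | inr b => pp_sol psi (map_mx h (b : 'rV[M]_m) - (c b : 'rV[N]_m))
  end.
have condE (P : rmod R) (y : M -> P) k : cond_holds y (cond k) <->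
  match k with
  | inl (a, x, x') => y (a *: x + x') = a *: y x + y x'
  | inr b => pp_sol phi (map_mx y (b : 'rV[M]_m))
  end.
  case: k => [[[a x] x']|b]; rewrite /cond_holds /=.
    apply: (iff_trans (zero_ppP _)).
    have -> : cond_row y (cond (inl (a, x, x'))) =
        const_mx (y (a *: x + x') - (a *: y x + y x')).
      apply/rowP=> i; rewrite !mxE /lin_comb !big_cons big_nil /= /ract.
      by rewrite scale1r scaleNr scaleN1r addr0 opprD.
    split=> [/rowP/(_ 0)|->]; rewrite ?subrr; last by apply/rowP=> i; rewrite !mxE.
    by rewrite !mxE => /eqP; rewrite subr_eq0 => /eqP.
  have -> // : cond_row y (cond (inr b)) = map_mx y (b : 'rV[M]_m).
  by apply/rowP=> i; rewrite !mxE /lin_comb big_seq1 /ract scale1r.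
(* A finite part of [M] is copied into some [Y] in [X] by a partial section [y] of [u]; composing
   [y] with a lift [h] of [g \o fmap G u] gives the partial solution. *)
have Hh (s : seq K) : exists h : M -> N, forall k, k \in s -> solves h k.
  pose E (k : K) : seq M := if k is inr b then codom ((b : 'rV[M]_m) 0) else [::].
  have [k _|Y [u [y [XY uy yP]]]] :=
      finite_system_stage X_cf MX (c := cond) (z := id)
        (flatten [seq E k | k <- s]) (s := s).
    apply/condE; case: k => [[[a x] x']|b] //.
    by rewrite map_mx_id //; apply: pp_groupP.
  have YC : C Y by move=> C' _; apply.
  pose Yo := Obj YC.
  have [h hE] := full_from_finite
    (g \o fmap G (u : {linear Yo -> M}) : {linear G Yo -> G N}) XY (G_fp Yo XY).
  exists (h \o y) => k sk; have /condE := yP k sk; case: k sk => [[[a x] x']|b] sk /=.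
    by move=> ->; rewrite linearP.
  move/(pp_group_of_sol (M := Yo)) => [q qE].
  have -> : map_mx (h \o y) (b : 'rV[M]_m) = pp_group_map h q.
    by rewrite /= qE map_mx_comp.
  apply/cls_eq; rewrite -cls_map hE.
  rewrite -[LHS]/(g (@fmap _ _ _ _ G Yo M u (cls q))) cls_map -cE; congr (g (cls _)).
  apply/val_inj/rowP=> i; rewrite /= qE !mxE; apply: uy.
  apply/flatten_mapP; exists (inr b) => //; exact: codom_f.
have [h hP] := choice Hh.
(* The index set is that of finite lists of conditions under inclusion; condition [k] holds for
   [h s] as soon as [s] contains [k]. *)
pose le (s t : seq K) := {subset s <= t}.
have le_dir : directed le.
  split=> [|s x //|s t w st tw x /st/tw //|s t]; first by split; exact: [::].
  by exists (s ++ t); split=> x; rewrite mem_cat => ->; rewrite ?orbT.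
have solvesE k : eventually le (fun s => solves (h s) k).
  by exists [:: k] => s ks; apply/hP/ks/mem_head.
have [r [r_eq r_pp]] := reduced_power_retraction le_dir N_pi.
have [a x y|f fE] := @linear_of_fun R M N (fun x => r (fun s => h s x)).
  rewrite -linearP; apply: r_eq.
  by have [s0 Hs0] := solvesE (inl (a, x, y)); exists s0 => s /Hs0.
exists f => v; have [b ->] := cls_surj v; rewrite cls_map cE; apply/cls_eq.
have -> : pp_group_map f b =
    map_mx r (map_mx (fun x s => h s x) (b : 'rV[M]_m)) :> 'rV[N]_m.
  by apply/rowP=> i; rewrite !mxE fE.
apply: r_pp; have [s0 Hs0] := solvesE (inr b); exists s0 => s /Hs0 /=.
by congr (pp_sol _ (_ - _)); apply/rowP=> i; rewrite !mxE.
Qed.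

End PPFunctor.

Lemma finitely_presented_iso (R : pzRingType) (M N : rmod R) (f : {linear M -> N}) :
  bijective f -> finitely_presented M -> finitely_presented N.
Proof.
move=> /linear_inverse[g [fK gK]] [n [k [A [x [gen xA rel]]]]].
exists n, k, A, (map_mx f x); split=> [m||r].
- have [r xr] := gen (g m); exists r.
  by rewrite rmulmx_map xr map_const_mx gK.
- by rewrite rmulmx_map xA map_mx0.
- rewrite rmulmx_map => fxr; apply: rel; apply/rowP=> j.
  apply: (can_inj fK); move/rowP/(_ j): fxr.
  by rewrite !mxE linear0.
Qed.

Theorem theorem2p4 (R S : pzRingType)
    (X : rmod R -> Prop) (D : rmod S -> Prop)
    (hX : covariantly_finite X) (hD : definable D)
    (I : additive_functor (definable_closure X) D)
    (hI : interpretation_functor I)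
    (hfull : forall M N : obj (definable_closure X), X M -> X N ->
       forall g : {linear I M -> I N},
         exists f : {linear M -> N}, fmap I f =1 g)
    (hfp : forall M : obj (definable_closure X),
       finitely_presented M -> finitely_presented (I M)) :
  forall N' N : obj (definable_closure X),
    pure_injective N' -> pure_injective N ->
    forall g : {linear I N' -> I N},
      exists h : {linear N' -> N}, fmap I h =1 g.
Proof.
move=> N' N _ N_pi g; have [d [theta [theta_bij theta_nat]]] := hI.
have Hinv M := linear_inverse (theta_bij M).
pose eta M := projT1 (cid (Hinv M)).
have [thetaK etaK] : (forall M, cancel (theta M) (eta M)) /\
    (forall M, cancel (eta M) (theta M)).
  by split=> M; case: (projT2 (cid (Hinv M))).
(* Fullness on [X], finite presentation and [g] are carried to the pp-functor by conjugation with
   [theta]. *)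
have [||h hE] := @full_to_pure_injective R S X D hX d _ N' N
  (theta N \o g \o eta N' : {linear _ -> _}) _ N_pi.
- move=> M P XM XP k.
  have [f fE] := hfull M P XM XP (eta P \o k \o theta M : {linear _ -> _}).
  exists f => v; rewrite -[v]etaK.
  have /= <- := theta_nat M P f (eta M v).
  by rewrite fE /= !etaK.
- by move=> M /(cf_fp hX)/hfp; apply: finitely_presented_iso.
exists h => v; apply: (can_inj (thetaK N)).
by have /= -> := theta_nat N' N h v; rewrite hE /= thetaK.
Qed.
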